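(* Let $d\in\{1,2\}$, assume $\Phi=0$, let $\theta\in[0,1]$, and let $\Delta t>0$ satisfy $$\left(\frac{\varepsilon\,C_A d}{2\min_j\Delta x^{(j)}}-\frac{1-\theta}{4\|\bm{\Omega}\|_\infty}\sigma_0^s\right)\Delta t\le\frac{\varepsilon^2}{2\|\bm{\Omega}\|_\infty},\qquad C_A=\|\bm{\Omega}\|_\infty=1.$$ Then the low-rank IMEX-S-BUG scheme (defined in the context) is $\theta$-stable: for all $n\ge0$, $E_\theta^{n+1}\le E_\theta^n$, where $$E_\theta^n=|D_{\bm{\Omega}}|\,\|\bm{\rho}^n\|^2+\varepsilon^2\|\bm{G}^n\|_w^2+(1-\theta)\Delta t\,\sigma_0^s\|\bm{G}^n\|_w^2,\qquad \bm{G}^n\bm{M}=\bm{X}^n\bm{S}^n(\bm{V}^n)^\top.$$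
   Context: Parameters: $\varepsilon>0$ (Knudsen number), scattering coefficient $\sigma^s(\bm{x})\ge\sigma_0^s>0$, absorption coefficient $\sigma^a(\bm{x})\ge0$, source $\Phi$; space dimension $d\in\{1,2\}$, periodic boundary conditions. Angular discretization ($S_N$): nodes $\bm{\Omega}_k=(\Omega_k^{(1)},\dots,\Omega_k^{(d)})$ and weights $w_k>0$, $k=1,\dots,N_{\bm{\Omega}}$ (for $d=2$ the Chebyshev–Legendre product rule projected onto the plane), with $|\Omega_k^{(j)}|\le1=\|\bm{\Omega}\|_\infty$, $\sum_k w_k=|D_{\bm{\Omega}}|$ ($|D_{\bm{\Omega}}|=2$ for $d=1$, $2\pi$ for $d=2$), and $\sum_k w_k\Omega_k^{(j)}=0$. Put $\bm{w}=(w_1,\dots,w_{N_{\bm{\Omega}}})^\top$, $\bm{1}$ the all-ones vector, $\bm{Q}^{(j)}=\mathrm{diag}(\Omega_k^{(j)})$, $|\bm{Q}^{(j)}|=\mathrm{diag}(|\Omega_k^{(j)}|)$, $\bm{Q}^{(j),\pm}=\frac12(\bm{Q}^{(j)}\pm|\bm{Q}^{(j)}|)$, $\bm{M}=\mathrm{diag}(\sqrt{w_k})$. Staggered periodic grid: mesh sizes $\Delta x^{(j)}$. For $d=1$, $\bm{\rho}$ lives at cell centers $x_i$ and $\bm{G}$ at interfaces $x_{i+1/2}$. For $d=2$, $\bm{\rho}$ lives at $(x_i,y_j)$ and $(x_{i+1/2},y_{j+1/2})$, $\bm{G}$ at $(x_{i+1/2},y_j)$ and $(x_i,y_{j+1/2})$.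 Thus $\bm{\rho}\in\mathbb{R}^{N_\rho}$, $\bm{G}\in\mathbb{R}^{N_{\bm{g}}\times N_{\bm{\Omega}}}$, $N_\rho=N_{\bm{g}}$. $\mathcal{D}^{(j),\pm}$ are the periodic first-order one-sided differences in direction $j$: acting from the $\bm{G}$-grid to itself, $(\mathcal{D}^{(j),-}u)(p)=\frac{u(p)-u(p-\Delta x^{(j)}e_j)}{\Delta x^{(j)}}$, $(\mathcal{D}^{(j),+}u)(p)=\frac{u(p+\Delta x^{(j)}e_j)-u(p)}{\Delta x^{(j)}}$; in $\mathcal{H}$ (from the $\bm{G}$-grid to the $\bm{\rho}$-grid) and in $\mathcal{J}$ (from the $\bm{\rho}$-grid to the $\bm{G}$-grid) they are the staggered differences $\frac{u(p+\frac12\Delta x^{(j)}e_j)-u(p-\frac12\Delta x^{(j)}e_j)}{\Delta x^{(j)}}$. They act column-wise on matrices. $\bm{\sigma}^s,\bm{\sigma}^a$ are the diagonal matrices of values of $\sigma^s,\sigma^a$ on the relevant grid. Operators: $\mathcal{A}(\bm{G})=\sum_{j=1}^d(\mathcal{D}^{(j),-}\bm{G}\bm{Q}^{(j),+}+\mathcal{D}^{(j),+}\bm{G}\bm{Q}^{(j),-})$, $\mathcal{H}(\bm{G})=\frac1{|D_{\bm{\Omega}}|}\sum_{j=1}^d\mathcal{D}^{(j),-}\bm{G}\bm{Q}^{(j)}\bm{w}$, $\mathcal{J}(\bm{\rho})=\sum_{j=1}^d\mathcal{D}^{(j),+}\bm{\rho}\,\bm{1}^\top\bm{Q}^{(j)}$,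 $\mathcal{B}(\bm{Y})=\mathcal{A}(\bm{Y}\bm{M}^{-1})\big(\mathbf{I}-\frac1{|D_{\bm{\Omega}}|}\bm{w}\bm{1}^\top\big)\bm{M}$. Inner products: $\langle\bm{f}_1,\bm{f}_2\rangle=(\prod_j\Delta x^{(j)})\bm{f}_1^\top\bm{f}_2$, $\langle\bm{F}_1,\bm{F}_2\rangle_w=(\prod_j\Delta x^{(j)})\mathrm{Tr}(\bm{F}_1\bm{M}^2\bm{F}_2^\top)$, with norms $\|\cdot\|$, $\|\cdot\|_w$. IMEX-S-BUG scheme of rank $r$. At time $t_n$: $\bm{\rho}^n$ and $\bm{G}^n\bm{M}=\bm{X}^n\bm{S}^n(\bm{V}^n)^\top$ with $\bm{X}^n\in\mathbb{R}^{N_{\bm{g}}\times r}$, $\bm{V}^n\in\mathbb{R}^{N_{\bm{\Omega}}\times r}$ having orthonormal columns, $\bm{S}^n\in\mathbb{R}^{r\times r}$, and zero-density constraint $\bm{1}^\top\bm{M}\bm{V}^n=\bm{0}^\top$ (so $\bm{G}^n\bm{w}=\bm{0}$). One step, with $R=\big(\frac1{\Delta t}+\frac{\bm{\sigma}^s}{\varepsilon^2}+\bm{\sigma}^a\big)^{-1}$ (diagonal matrix on the $\bm{G}$-grid): (0) Macroscopic step: $\bm{\rho}^{n+1}$ solves $$\Big(\tfrac1{\Delta t}+\bm{\sigma}^a\Big)\bm{\rho}^{n+1}-\tfrac1{\varepsilon^2}\mathcal{H}\big(R\,\mathcal{J}(\bm{\rho}^{n+1})\big)=\tfrac1{\Delta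 t}\bm{\rho}^n+\bm{\Phi}^{n+1}-\mathcal{H}\Big(R\big(\tfrac1{\Delta t}\bm{G}^n-\tfrac1\varepsilon\mathcal{A}(\bm{G}^n)(\mathbf{I}-\tfrac1{|D_{\bm{\Omega}}|}\bm{w}\bm{1}^\top)\big)\Big).$$ (1) K-step: with $\bm{K}^n=\bm{X}^n\bm{S}^n$, solve for $\bm{K}^{n+1}$ $$\tfrac{\bm{K}^{n+1}-\bm{K}^n}{\Delta t}=-\tfrac1\varepsilon\mathcal{B}(\bm{K}^n(\bm{V}^n)^\top)\bm{V}^n-\tfrac1{\varepsilon^2}\mathcal{J}(\bm{\rho}^{n+1})\bm{M}\bm{V}^n-\tfrac1{\varepsilon^2}\bm{\sigma}^s\bm{K}^{n+1}-\bm{\sigma}^a\bm{K}^{n+1}.$$ (2) L-step: with $\bm{L}^n=\bm{V}^n(\bm{S}^n)^\top$, solve for $\bm{L}^{n+1}$ $$\tfrac{\bm{L}^{n+1}-\bm{L}^n}{\Delta t}=-\tfrac1\varepsilon\mathcal{B}(\bm{X}^n(\bm{L}^n)^\top)^\top\bm{X}^n-\tfrac1{\varepsilon^2}\bm{M}\mathcal{J}(\bm{\rho}^{n+1})^\top\bm{X}^n-\tfrac1{\varepsilon^2}\bm{L}^{n+1}(\bm{X}^n)^\top\bm{\sigma}^s\bm{X}^n-\bm{L}^{n+1}(\bm{X}^n)^\top\bm{\sigma}^a\bm{X}^n.$$ (3) Basis update: $\bm{X}^{n+1}$ and $\bm{V}^{n+1}$ are the orthonormal factors of QR factorizations of $\bm{K}^{n+1}$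 and $\bm{L}^{n+1}$ ($r$ orthonormal columns whose span contains the range of $\bm{K}^{n+1}$, resp. $\bm{L}^{n+1}$), the second computed so that $\bm{1}^\top\bm{M}\bm{V}^{n+1}=\bm{0}^\top$ (QR performed within the orthogonal complement of $\bm{M}\bm{1}$). (4) S-step: with $\widetilde{\bm{S}}^n=(\bm{X}^{n+1})^\top\bm{X}^n\bm{S}^n(\bm{V}^n)^\top\bm{V}^{n+1}$, solve for $\bm{S}^{n+1}$ $$\tfrac{\bm{S}^{n+1}-\widetilde{\bm{S}}^n}{\Delta t}=-\tfrac1\varepsilon(\bm{X}^{n+1})^\top\mathcal{B}(\bm{X}^{n+1}\widetilde{\bm{S}}^n(\bm{V}^{n+1})^\top)\bm{V}^{n+1}-\tfrac1{\varepsilon^2}(\bm{X}^{n+1})^\top\mathcal{J}(\bm{\rho}^{n+1})\bm{M}\bm{V}^{n+1}-\tfrac1{\varepsilon^2}(\bm{X}^{n+1})^\top\bm{\sigma}^s\bm{X}^{n+1}\bm{S}^{n+1}-(\bm{X}^{n+1})^\top\bm{\sigma}^a\bm{X}^{n+1}\bm{S}^{n+1}.$$ (5) Set $\bm{G}^{n+1}\bm{M}=\bm{X}^{n+1}\bm{S}^{n+1}(\bm{V}^{n+1})^\top$. *)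

(* Defs.v *)
From mathcomp Require Import all_boot all_order all_algebra.
From mathcomp Require Import reals trigo.

Set Implicit Arguments.
Unset Strict Implicit.
Unset Printing Implicit Defensive.

Import Order.TTheory GRing.Theory Num.Theory.

Local Open Scope ring_scope.

Record grid (R : realType) (d : nat) := Grid {
  ncell : 'I_d -> nat;
  dx : 'I_d -> R;
  origin : 'rV[R]_d;
  ncell_gt0 : forall j, (0 < ncell j)%N;
  dx_gt0 : forall j, 0 < dx j }.

(* The periodic half-step lattice: p j counts steps of length dx j / 2 modulo
   2 * ncell j, and even (odd) p j is an integer (half-integer) position in
   direction j. *)
Definition lattice (R : realType) (d : nat) (g : grid R d) : finType :=
  {dffun forall j : 'I_d, 'I_((ncell g j).*2)}.

(* Total parity separates the two staggered grids. Even: cell centers if d = 1,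
   and (x_i, y_j), (x_{i+1/2}, y_{j+1/2}) if d = 2; this carries rho.
   Odd: interfaces if d = 1, and (x_{i+1/2}, y_j), (x_i, y_{j+1/2}) if d = 2;
   this carries G. *)
Definition parity (R : realType) (d : nat) (g : grid R d) (p : lattice g) :
  bool := odd (\sum_(j < d) p j).

Definition site (R : realType) (d : nat) (g : grid R d) (b : bool) : finType :=
  {p : lattice g | parity p == b}.

Definition rho_site (R : realType) (d : nat) (g : grid R d) := site g false.
Definition G_site (R : realType) (d : nat) (g : grid R d) := site g true.

Definition Nrho (R : realType) (d : nat) (g : grid R d) : nat := #|rho_site g|.
Definition Ng (R : realType) (d : nat) (g : grid R d) : nat := #|G_site g|.

Definition coord (R : realType) (d : nat) (g : grid R d) (p : lattice g) :
  'rV[R]_d := \row_j (origin g ord0 j + (p j)%:R * (dx g j / 2)).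

(* p + (dx j / 2) e_j and p - (dx j / 2) e_j, with periodic wrap-around. *)
Definition lat_fwd (R : realType) (d : nat) (g : grid R d) (j : 'I_d)
  (p : lattice g) : lattice g :=
  [ffun k => if k == j then ordS (p k) else p k].
Definition lat_bwd (R : realType) (d : nat) (g : grid R d) (j : 'I_d)
  (p : lattice g) : lattice g :=
  [ffun k => if k == j then ord_pred (p k) else p k].

Lemma odd_ordS n (i : 'I_(n.*2)) : odd (ordS i) = ~~ odd i.
Proof. by rewrite /= odd_mod ?odd_double. Qed.

Lemma odd_ord_pred n (i : 'I_(n.*2)) : odd (ord_pred i) = ~~ odd i.
Proof. by rewrite -[in RHS](ord_predK i) odd_ordS negbK. Qed.

Lemma parity_fwd (R : realType) (d : nat) (g : grid R d) (j : 'I_d)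
  (p : lattice g) : parity (lat_fwd j p) = ~~ parity p.
Proof.
rewrite /parity (bigD1 j) //= [in RHS](bigD1 j) //= !oddD ffunE eqxx odd_ordS.
rewrite -addNb; congr (_ (+) odd _).
by apply: eq_bigr => k /negPf kj; rewrite ffunE kj.
Qed.

Lemma parity_bwd (R : realType) (d : nat) (g : grid R d) (j : 'I_d)
  (p : lattice g) : parity (lat_bwd j p) = ~~ parity p.
Proof.
rewrite /parity (bigD1 j) //= [in RHS](bigD1 j) //= !oddD ffunE eqxx.
rewrite odd_ord_pred -addNb; congr (_ (+) odd _).
by apply: eq_bigr => k /negPf kj; rewrite ffunE kj.
Qed.

Lemma site_fwd_subproof (R : realType) (d : nat) (g : grid R d) (j : 'I_d)
  (b : bool) (p : site g b) : parity (lat_fwd j (val p)) == ~~ b.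
Proof. by rewrite parity_fwd (eqP (valP p)). Qed.

Lemma site_bwd_subproof (R : realType) (d : nat) (g : grid R d) (j : 'I_d)
  (b : bool) (p : site g b) : parity (lat_bwd j (val p)) == ~~ b.
Proof. by rewrite parity_bwd (eqP (valP p)). Qed.

Definition site_fwd (R : realType) (d : nat) (g : grid R d) (j : 'I_d)
  (b : bool) (p : site g b) : site g (~~ b) :=
  Sub (lat_fwd j (val p)) (site_fwd_subproof j p).
Definition site_bwd (R : realType) (d : nat) (g : grid R d) (j : 'I_d)
  (b : bool) (p : site g b) : site g (~~ b) :=
  Sub (lat_bwd j (val p)) (site_bwd_subproof j p).

(* The row of U attached to a grid point. *)
Definition at_site (R : realType) (T : finType) (m : nat) (U : 'M[R]_(#|T|, m))
  (p : T) : 'rV[R]_m := row (enum_rank p) U.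

(* One-sided differences from the G-grid to itself; full steps are two half
   steps. *)
Definition Dminus (R : realType) (d : nat) (g : grid R d) (m : nat) (j : 'I_d)
  (U : 'M[R]_(Ng g, m)) : 'M[R]_(Ng g, m) :=
  \matrix_(i < Ng g) ((dx g j)^-1 *:
    (at_site U (enum_val i : G_site g)
     - at_site U (site_bwd j (site_bwd j (enum_val i : G_site g)) : G_site g))).
Definition Dplus (R : realType) (d : nat) (g : grid R d) (m : nat) (j : 'I_d)
  (U : 'M[R]_(Ng g, m)) : 'M[R]_(Ng g, m) :=
  \matrix_(i < Ng g) ((dx g j)^-1 *:
    (at_site U (site_fwd j (site_fwd j (enum_val i : G_site g)) : G_site g)
     - at_site U (enum_val i : G_site g))).

(* Staggered differences: the D^- of H (G-grid to rho-grid) and the D^+ of J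
   (rho-grid to G-grid). *)
Definition DminusH (R : realType) (d : nat) (g : grid R d) (m : nat) (j : 'I_d)
  (U : 'M[R]_(Ng g, m)) : 'M[R]_(Nrho g, m) :=
  \matrix_(i < Nrho g) ((dx g j)^-1 *:
    (at_site U (site_fwd j (enum_val i : rho_site g) : G_site g)
     - at_site U (site_bwd j (enum_val i : rho_site g) : G_site g))).
Definition DplusJ (R : realType) (d : nat) (g : grid R d) (m : nat) (j : 'I_d)
  (U : 'M[R]_(Nrho g, m)) : 'M[R]_(Ng g, m) :=
  \matrix_(i < Ng g) ((dx g j)^-1 *:
    (at_site U (site_fwd j (enum_val i : G_site g) : rho_site g)
     - at_site U (site_bwd j (enum_val i : G_site g) : rho_site g))).

(* |D_Omega|, meaningful for d = 1 and d = 2 only. *)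
Definition measD (R : realType) (d : nat) : R := if d == 1%N then 2 else 2 * pi.

(* The constant ||Omega||_inf = 1 bounding every |Omega_k^(j)|; it is not the
   maximum over the nodes. *)
Definition Omega_inf (R : realType) : R := 1.
Definition C_A (R : realType) : R := Omega_inf R.

Record quadrature (R : realType) (d N : nat) := Quadrature {
  node : 'I_N -> 'I_d -> R;
  weight : 'I_N -> R;
  weight_gt0 : forall k, 0 < weight k;
  node_le : forall k j, `|node k j| <= Omega_inf R;
  weight_sum : \sum_(k < N) weight k = measD R d;
  weight_node_sum : forall j, \sum_(k < N) weight k * node k j = 0 }.

Section Angular.
Context (R : realType) (d N : nat) (q : quadrature R d N).

Definition wvec : 'cV[R]_N := \col_k weight q k.
Definition ones : 'cV[R]_N := const_mx 1.
Definition Mmx : 'M[R]_N := diag_mx (\row_k Num.sqrt (weight q k)).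
Definition Qmx (j : 'I_d) : 'M[R]_N := diag_mx (\row_k node q k j).
Definition absQmx (j : 'I_d) : 'M[R]_N := diag_mx (\row_k `|node q k j|).
Definition Qplus (j : 'I_d) : 'M[R]_N := 2^-1 *: (Qmx j + absQmx j).
Definition Qminus (j : 'I_d) : 'M[R]_N := 2^-1 *: (Qmx j - absQmx j).
Definition zero_mean_proj : 'M[R]_N :=
  1%:M - (measD R d)^-1 *: (wvec *m ones^T).

End Angular.

Section Operators.
Context (R : realType) (d N : nat) (g : grid R d) (q : quadrature R d N).

Definition Aop (G : 'M[R]_(Ng g, N)) : 'M[R]_(Ng g, N) :=
  \sum_(j < d) (Dminus j G *m Qplus q j + Dplus j G *m Qminus q j).

Definition Hop (G : 'M[R]_(Ng g, N)) : 'cV[R]_(Nrho g) :=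
  (measD R d)^-1 *: \sum_(j < d) (DminusH j G *m Qmx q j *m wvec q).

Definition Jop (rho : 'cV[R]_(Nrho g)) : 'M[R]_(Ng g, N) :=
  \sum_(j < d) (DplusJ j rho *m (ones R N)^T *m Qmx q j).

Definition Bop (Y : 'M[R]_(Ng g, N)) : 'M[R]_(Ng g, N) :=
  Aop (Y *m invmx (Mmx q)) *m zero_mean_proj q *m Mmx q.

Definition cell_vol : R := \prod_(j < d) dx g j.

Definition dot_rho (f1 f2 : 'cV[R]_(Nrho g)) : R :=
  cell_vol * (f1^T *m f2) ord0 ord0.
Definition norm_rho (f : 'cV[R]_(Nrho g)) : R := Num.sqrt (dot_rho f f).

Definition dot_w (F1 F2 : 'M[R]_(Ng g, N)) : R :=
  cell_vol * \tr (F1 *m (Mmx q *m Mmx q) *m F2^T).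
Definition norm_w (F : 'M[R]_(Ng g, N)) : R := Num.sqrt (dot_w F F).

Definition min_dx : R :=
  if [pick j : 'I_d] is Some j0 then \big[Num.min/dx g j0]_(j < d) dx g j
  else 0.

(* Diagonal matrices of the values of a coefficient on the two grids. *)
Definition on_rho_grid (s : 'rV[R]_d -> R) : 'M[R]_(Nrho g) :=
  diag_mx (\row_i s (coord (val (enum_val i : rho_site g)))).
Definition on_G_grid (s : 'rV[R]_d -> R) : 'M[R]_(Ng g) :=
  diag_mx (\row_i s (coord (val (enum_val i : G_site g)))).

Definition energy (eps sigma0 theta dt : R) (rho : 'cV[R]_(Nrho g))
  (G : 'M[R]_(Ng g, N)) : R :=
  measD R d * norm_rho rho ^+ 2 + eps ^+ 2 * norm_w G ^+ 2
  + (1 - theta) * dt * sigma0 * norm_w G ^+ 2.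

End Operators.

(* X consists of orthonormal columns whose span contains the range of K; only
   these properties of a QR factorization are used. *)
Definition qr_basis (R : realType) (m r : nat) (K X : 'M[R]_(m, r)) : Prop :=
  X^T *m X = 1%:M /\ exists T : 'M[R]_r, K = X *m T.

Record lr_state (R : realType) (d N : nat) (g : grid R d) (r : nat) := LrState {
  st_rho : 'cV[R]_(Nrho g);
  st_G : 'M[R]_(Ng g, N);
  st_X : 'M[R]_(Ng g, r);
  st_S : 'M[R]_r;
  st_V : 'M[R]_(N, r) }.

Definition admissible (R : realType) (d N : nat) (g : grid R d)
  (q : quadrature R d N) (r : nat) (u : lr_state N g r) : Prop :=
  [/\ st_G u *m Mmx q = st_X u *m st_S u *m (st_V u)^T,
      (st_X u)^T *m st_X u = 1%:M,
      (st_V u)^T *m st_V u = 1%:M &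
      (ones R N)^T *m Mmx q *m st_V u = 0].

Section Scheme.
Context (R : realType) (d N : nat) (g : grid R d) (q : quadrature R d N).
Context (eps dt : R) (sigma_s sigma_a : 'rV[R]_d -> R).

Let M : 'M[R]_N := Mmx q.
Let P : 'M[R]_N := zero_mean_proj q.
Let sS : 'M[R]_(Ng g) := on_G_grid g sigma_s.
Let sA : 'M[R]_(Ng g) := on_G_grid g sigma_a.

Definition Rmx : 'M[R]_(Ng g) := invmx ((dt^-1)%:M + (eps ^+ 2)^-1 *: sS + sA).

Definition macro_step (Phi' rho : 'cV[R]_(Nrho g)) (G : 'M[R]_(Ng g, N))
  (rho' : 'cV[R]_(Nrho g)) : Prop :=
  ((dt^-1)%:M + on_rho_grid g sigma_a) *m rho'
    - (eps ^+ 2)^-1 *: Hop q (Rmx *m Jop q rho')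
  = dt^-1 *: rho + Phi'
    - Hop q (Rmx *m (dt^-1 *: G - eps^-1 *: (Aop q G *m P))).

Definition K_step (r : nat) (rho' : 'cV[R]_(Nrho g)) (K : 'M[R]_(Ng g, r))
  (V : 'M[R]_(N, r)) (K' : 'M[R]_(Ng g, r)) : Prop :=
  dt^-1 *: (K' - K)
  = - (eps^-1 *: (Bop q (K *m V^T) *m V))
    - (eps ^+ 2)^-1 *: (Jop q rho' *m M *m V)
    - (eps ^+ 2)^-1 *: (sS *m K') - sA *m K'.

Definition L_step (r : nat) (rho' : 'cV[R]_(Nrho g)) (X : 'M[R]_(Ng g, r))
  (L L' : 'M[R]_(N, r)) : Prop :=
  dt^-1 *: (L' - L)
  = - (eps^-1 *: ((Bop q (X *m L^T))^T *m X))
    - (eps ^+ 2)^-1 *: (M *m (Jop q rho')^T *m X)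
    - (eps ^+ 2)^-1 *: (L' *m X^T *m sS *m X) - L' *m X^T *m sA *m X.

Definition S_step (r : nat) (rho' : 'cV[R]_(Nrho g)) (X' : 'M[R]_(Ng g, r))
  (V' : 'M[R]_(N, r)) (St S' : 'M[R]_r) : Prop :=
  dt^-1 *: (S' - St)
  = - (eps^-1 *: (X'^T *m Bop q (X' *m St *m V'^T) *m V'))
    - (eps ^+ 2)^-1 *: (X'^T *m Jop q rho' *m M *m V')
    - (eps ^+ 2)^-1 *: (X'^T *m sS *m X' *m S') - X'^T *m sA *m X' *m S'.

Definition imex_s_bug_step (r : nat) (Phi' : 'cV[R]_(Nrho g))
  (u u' : lr_state N g r) : Prop :=
  exists (K' : 'M[R]_(Ng g, r)) (L' : 'M[R]_(N, r)),
    macro_step Phi' (st_rho u) (st_G u) (st_rho u') /\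
    K_step (st_rho u') (st_X u *m st_S u) (st_V u) K' /\
    L_step (st_rho u') (st_X u) (st_V u *m (st_S u)^T) L' /\
    qr_basis K' (st_X u') /\
    qr_basis L' (st_V u') /\
    (ones R N)^T *m M *m st_V u' = 0 /\
    S_step (st_rho u') (st_X u') (st_V u')
      ((st_X u')^T *m st_X u *m st_S u *m (st_V u)^T *m st_V u') (st_S u') /\
    st_G u' *m M = st_X u' *m st_S u' *m (st_V u')^T.

End Scheme.

(* Main.v *)
Require Import Defs.
From mathcomp Require Import all_boot all_order all_algebra.
From mathcomp Require Import reals trigo.
From mathcomp Require Import ring lra.
Set Implicit Arguments.
Unset Strict Implicit.
Unset Printing Implicit Defensive.
Import Order.TTheory GRing.Theory Num.Theory.
Local Open Scope ring_scope.

(** Write [Y = G M], so that the weighted norm of [G] is the Frobenius norm of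
    [Y]; let [C = 1/dt + sigma_s/eps^2 + sigma_a] be the diagonal implicit
    operator, [F Y = Y/dt - B Y/eps] the explicit part and
    [J = Jop rho' M / eps^2] the coupling. The macroscopic step is driven by
    the full-rank update [C^-1 (F Y - J)], whereas the low-rank update [Y']
    only solves [C Y' = F Yt - J] tested against matrices [X' S V'^T], where
    [Yt] is the orthogonal projection of [Y] to the new bases. The two updates
    differ, so the coupling terms of the two energy balances do not cancel.
    The mismatch is nevertheless absorbed, as follows.

    Testing the macroscopic step with [rho'], and using that [Hop] and [Jop]
    are adjoint up to sign ([Hop_Jop_adjoint]), bounds the growth of the
    density energy by [2 <C^-1 (F Y - J), J>] ([macro_step_energy]). Testing
    the S-step with [Y'] shows that [Y'] is the [C]-orthogonal projection of
    [C^-1 (F Yt - J)], so [<C Y', Y'> <= <C^-1 (F Yt - J), F Yt - J>]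
    ([galerkin_frob_le]). Put [Z = Y - Yt]. On adding the two bounds the terms
    [<C^-1 F Yt, J>] cancel, the squares in [J] leave [- <C^-1 J, J>], and
    Young's inequality for [<C^-1 F Z, J>] gives ([coupled_energy_le])
      [2 <C^-1 (F Y - J), J> + <C Y', Y'>
         <= <C^-1 F Yt, F Yt> + <C^-1 F Z, F Z>].
    Projecting [Y] therefore costs nothing, provided that the explicit step
    is stable on [Yt] and on the discarded part [Z] separately, because
    [|Y|^2 = |Yt|^2 + |Z|^2].

    That stability is where the time step restriction enters. With
    [kappa = 1/dt + (1 - theta) sigma0 / eps^2], which is a lower bound of [C]
    and, up to the factor [eps^2 dt], the coefficient of [|Y|^2] in the energy,
    the restriction reads [2 d / (eps min dx) - 1/dt <= kappa]. On matrices of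
    zero density [F] is an upwind step followed by an orthogonal projection;
    the upwind step is a combination of periodic shifts whose coefficients
    have absolute values summing to at most [kappa]. Hence
    [|F A| <= kappa |A|] ([explicit_part_le]) and
    [<C^-1 F A, F A> <= kappa |A|^2] for [A = Yt] and [A = Z]. The
    constraint [1^T M V' = 0] is what keeps [Yt], hence [Z], of zero density.
    *)

(** * Frobenius inner product *)

Section Frobenius.
Context (R : realType).

Definition frob m n (A B : 'M[R]_(m, n)) : R := \tr (A *m B^T).

Lemma frobE m n (A B : 'M[R]_(m, n)) :
  frob A B = \sum_i \sum_k A i k * B i k.
Proof.
by apply: eq_bigr => i _; rewrite mxE; apply: eq_bigr => k _; rewrite mxE.
Qed.

Lemma frobC m n (A B : 'M[R]_(m, n)) : frob A B = frob B A.
Proof. by rewrite /frob -mxtrace_tr trmx_mul trmxK. Qed.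

Lemma frobDl m n (A B C : 'M[R]_(m, n)) :
  frob (A + B) C = frob A C + frob B C.
Proof. by rewrite /frob mulmxDl raddfD. Qed.

Lemma frobDr m n (A B C : 'M[R]_(m, n)) :
  frob C (A + B) = frob C A + frob C B.
Proof. by rewrite frobC frobDl !(frobC C). Qed.

Lemma frobZl m n (a : R) (A B : 'M[R]_(m, n)) :
  frob (a *: A) B = a * frob A B.
Proof. by rewrite /frob -scalemxAl linearZ. Qed.

Lemma frobZr m n (a : R) (A B : 'M[R]_(m, n)) :
  frob A (a *: B) = a * frob A B.
Proof. by rewrite frobC frobZl frobC. Qed.

Lemma frobNl m n (A B : 'M[R]_(m, n)) : frob (- A) B = - frob A B.
Proof. by rewrite -scaleN1r frobZl mulN1r. Qed.

Lemma frobNr m n (A B : 'M[R]_(m, n)) : frob A (- B) = - frob A B.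
Proof. by rewrite frobC frobNl frobC. Qed.

Lemma frob0l m n (A : 'M[R]_(m, n)) : frob 0 A = 0.
Proof. by rewrite /frob mul0mx raddf0. Qed.

Lemma frob_suml m n (I : finType) (F : I -> 'M[R]_(m, n)) B :
  frob (\sum_i F i) B = \sum_i frob (F i) B.
Proof.
by apply: (big_morph (fun A => frob A B) _ (frob0l B)) => A C; apply: frobDl.
Qed.

Lemma frob_ge0 m n (A : 'M[R]_(m, n)) : 0 <= frob A A.
Proof.
by rewrite frobE; apply: sumr_ge0 => i _; apply: sumr_ge0 => k _; apply: sqr_ge0.
Qed.

Lemma frob_mull m n p (L : 'M[R]_(m, p)) (A : 'M[R]_(p, n)) B :
  frob (L *m A) B = frob A (L^T *m B).
Proof. by rewrite /frob trmx_mul trmxK -mulmxA mxtrace_mulC mulmxA. Qed.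

Lemma frob_mulr m n p (A : 'M[R]_(m, p)) (L : 'M[R]_(p, n)) B :
  frob (A *m L) B = frob A (B *m L^T).
Proof. by rewrite /frob trmx_mul trmxK mulmxA. Qed.

Lemma frob_diag m n (c : 'rV[R]_m) (A : 'M[R]_(m, n)) :
  frob (diag_mx c *m A) A = \sum_i c ord0 i * \sum_k A i k ^+ 2.
Proof.
rewrite frobE; apply: eq_bigr => i _; rewrite big_distrr /=.
by apply: eq_bigr => k _; rewrite mul_diag_mx mxE -mulrA.
Qed.

Lemma le_frob_diag m n (c : 'rV[R]_m) (kappa : R) (A : 'M[R]_(m, n)) :
  (forall i, kappa <= c ord0 i) -> kappa * frob A A <= frob (diag_mx c *m A) A.
Proof.
move=> kc; rewrite frob_diag frobE big_distrr /=; apply: ler_sum => i _.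
by apply: ler_wpM2r => //; apply: sumr_ge0 => k _; apply: sqr_ge0.
Qed.

Lemma frob_diag_le m n (c : 'rV[R]_m) (kappa : R) (A : 'M[R]_(m, n)) :
  (forall i, c ord0 i <= kappa) -> frob (diag_mx c *m A) A <= kappa * frob A A.
Proof.
move=> kc; rewrite frob_diag frobE big_distrr /=; apply: ler_sum => i _.
by apply: ler_wpM2r => //; apply: sumr_ge0 => k _; apply: sqr_ge0.
Qed.

Lemma frob_proj_le m n (A : 'M[R]_(m, n)) (P : 'M[R]_n) :
  P^T = P -> P *m P = P -> frob (A *m P) (A *m P) <= frob A A.
Proof.
move=> Psym Pid; rewrite -subr_ge0.
suff -> : frob A A - frob (A *m P) (A *m P)
  = frob (A *m (1%:M - P)) (A *m (1%:M - P)) by apply: frob_ge0.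
have PP (B : 'M[R]_(m, n)) : frob (A *m P) (B *m P) = frob A (B *m P).
  by rewrite frob_mulr Psym -mulmxA Pid.
rewrite mulmxBr mulmx1 !(frobDl, frobDr, frobNl, frobNr) PP (frobC _ A).
ring.
Qed.

(** Pythagoras for the compression of [Y] to the column spaces of [X], [V]. *)
Lemma frob_compress_split m n r (X : 'M[R]_(m, r)) (V : 'M[R]_(n, r))
  (Y Yt : 'M[R]_(m, n)) :
  X^T *m X = 1%:M -> V^T *m V = 1%:M ->
  Yt = X *m (X^T *m Y *m V) *m V^T ->
  frob Y Y = frob Yt Yt + frob (Y - Yt) (Y - Yt).
Proof.
move=> XX VV eYt.
suff h : frob Yt Y = frob Yt Yt.
  by rewrite !(frobDl, frobDr, frobNl, frobNr) (frobC Y Yt) h; ring.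
rewrite [in LHS]eYt {1}eYt !(frob_mulr _ V^T) !(frob_mull X) trmxK; congr (frob _ _).
by rewrite eYt !mulmxA XX mul1mx -!mulmxA VV mulmx1.
Qed.

End Frobenius.

(** * Implicit diagonal operator and low-rank coupling *)

Section DiagonalInverse.
Context (R : realType) (m n : nat) (c : 'rV[R]_m).
Hypothesis c_gt0 : forall i, 0 < c ord0 i.

Lemma diag_mx_unit : diag_mx c \in unitmx.
Proof.
by rewrite unitmxE det_diag unitfE; apply/prodf_neq0 => i _; rewrite gt_eqF.
Qed.

Lemma invmx_diag : invmx (diag_mx c) = diag_mx (\row_i (c ord0 i)^-1).
Proof.
rewrite -[RHS](mulKmx diag_mx_unit) mulmx_diag.
suff -> : diag_mx (\row_i (c ord0 i * (\row_i (c ord0 i)^-1) ord0 i)) = 1%:M.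
  by rewrite mulmx1.
rewrite -diag_const_mx; congr diag_mx; apply/rowP => i.
by rewrite !mxE divff ?gt_eqF.
Qed.

Lemma frob_invmx_sym (A B : 'M[R]_(m, n)) :
  frob (invmx (diag_mx c) *m A) B = frob (invmx (diag_mx c) *m B) A.
Proof. by rewrite frob_mull trmx_inv tr_diag_mx frobC. Qed.

Lemma frob_invmx_ge0 (A : 'M[R]_(m, n)) :
  0 <= frob (invmx (diag_mx c) *m A) A.
Proof.
rewrite -[leLHS](mul0r (frob A A)) invmx_diag; apply: le_frob_diag => i.
by rewrite mxE invr_ge0 ltW.
Qed.

(** The hypothesis says that [C^-1 F - Y] is orthogonal to [Y] in the inner
    product weighted by [C], as for a projection; by Pythagoras [Y] is not
    longer than [C^-1 F]. *)
Lemma galerkin_frob_le (F Y : 'M[R]_(m, n)) :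
  frob (diag_mx c *m Y) Y = frob F Y ->
  frob (diag_mx c *m Y) Y <= frob (invmx (diag_mx c) *m F) F.
Proof.
move=> hY; set Z := invmx (diag_mx c) *m F.
have CZ : diag_mx c *m Z = F by rewrite mulKVmx // diag_mx_unit.
have := @le_frob_diag R m n c 0 (Y - Z) (fun i => ltW (c_gt0 i)).
have hYZ : frob (diag_mx c *m Y) Z = frob F Y.
  by rewrite frob_mull tr_diag_mx CZ frobC.
rewrite mul0r mulmxBr CZ !(frobDl, frobDr, frobNl, frobNr) hY hYZ (frobC F Z).
by lra.
Qed.

(** The coupling [J] is paired with the unprojected update, while [Y] sees
    only the part [Ft] of the explicit data. Once [Y] is bounded by
    [Ft - J], the pairings of [J] with [Ft] cancel and
    [- <C^-1 J, J>] is left over, which pays for the pairing of [J] with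
    [Fz]. *)
Lemma coupled_energy_le (Ft Fz J Y : 'M[R]_(m, n)) :
  frob (diag_mx c *m Y) Y = frob (Ft - J) Y ->
  2 * frob (invmx (diag_mx c) *m (Ft + Fz - J)) J + frob (diag_mx c *m Y) Y
  <= frob (invmx (diag_mx c) *m Ft) Ft + frob (invmx (diag_mx c) *m Fz) Fz.
Proof.
move=> /galerkin_frob_le hg.
apply: (le_trans (lerD (lexx _) hg)).
have := frob_invmx_ge0 (Fz - J).
rewrite !(mulmxDr, mulmxN, frobDl, frobDr, frobNl, frobNr).
rewrite (frob_invmx_sym J Ft) (frob_invmx_sym J Fz).
by lra.
Qed.

End DiagonalInverse.

(** * Combinations of shifts *)

(** Every permutation of the sites is an isometry, so this is the triangle
    inequality in the squared Euclidean norm. *)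
Lemma shift_comb_le (R : realType) (T I : finType) (a : I -> R)
  (s : I -> T -> T) (y : T -> R) :
  (forall i, bijective (s i)) ->
  \sum_p (\sum_i a i * y (s i p)) ^+ 2
  <= (\sum_i `|a i|) ^+ 2 * \sum_p y p ^+ 2.
Proof.
move=> sb.
have sE i : \sum_p y (s i p) ^+ 2 = \sum_p y p ^+ 2.
  by rewrite [RHS](reindex (s i)) //; apply: onW_bij.
under eq_bigr do rewrite expr2 big_distrlr /=.
rewrite exchange_big expr2 mulrAC big_distrl /= big_distrl /=.
apply: ler_sum => i _; rewrite exchange_big -mulrA [X in _ * X]mulrC.
rewrite big_distrl big_distrr /=; apply: ler_sum => j _.
rewrite mulrA -normrM.
under eq_bigr do rewrite mulrACA.
rewrite -big_distrr /=; apply: (le_trans (ler_norm _)); rewrite normrM.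
apply: ler_wpM2l => //.
apply: (le_trans (ler_norm_sum _ _ _)).
apply: (@le_trans _ _ (\sum_p 2^-1 * (y (s i p) ^+ 2 + y (s j p) ^+ 2))).
  apply: ler_sum => p _; rewrite ler_norml.
  have := sqr_ge0 (y (s i p) + y (s j p)).
  have := sqr_ge0 (y (s i p) - y (s j p)).
  by move=> ? ?; apply/andP; split; lra.
by rewrite -big_distrr big_split /= !sE; lra.
Qed.

(** The step is the combination of the identity, with coefficient
    [a - m], and of shifts with total coefficient [m], where [m] is the sum of
    the [mu i]. Since [|a - m| + m] is the larger of [a] and [2 m - a], these
    are the two quantities to be bounded by [kappa]. *)
Lemma upwind_step_le (R : realType) (T I : finType) (a kappa : R) (mu : I -> R)
  (s : I -> T -> T) (y : T -> R) :
  (forall i, 0 <= mu i) -> (forall i, bijective (s i)) ->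
  a <= kappa -> 2 * (\sum_i mu i) - a <= kappa ->
  \sum_p (a * y p - \sum_i mu i * (y p - y (s i p))) ^+ 2
  <= kappa ^+ 2 * \sum_p y p ^+ 2.
Proof.
move=> mu0 sb ak mk; set m := \sum_i mu i in mk.
have m0 : 0 <= m by apply: sumr_ge0.
(* The extra index [inr tt] carries the identity shift. *)
pose b (o : I + unit) := if o is inl i then mu i else a - m.
pose t (o : I + unit) := if o is inl i then s i else id.
have tb o : bijective (t o) by case: o => [i|u] /=; [apply: sb | exists id].
apply: (@le_trans _ _ (\sum_p (\sum_o b o * y (t o p)) ^+ 2)).
  rewrite le_eqVlt; apply/orP; left; apply/eqP/eq_bigr => p _; congr (_ ^+ 2).
  rewrite big_sumType /= (big_pred1 tt) /m; last by case.
  under eq_bigr do rewrite mulrBr.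
  by rewrite sumrB -big_distrl /=; ring.
apply: (le_trans (shift_comb_le b y tb)).
apply: ler_wpM2r; first by apply: sumr_ge0 => p _; apply: sqr_ge0.
rewrite big_sumType (big_pred1 tt) /=; last by case.
under eq_bigr do rewrite ger0_norm //.
have km : m + `|a - m| <= kappa by case: (ger0P (a - m)) => h; lra.
rewrite -/m lerXn2r // nnegrE; first by rewrite addr_ge0.
by lra.
Qed.
(** * Staggered grid and difference operators *)

Section Grid.
Context (R : realType) (d : nat) (g : grid R d).

Lemma lat_fwdK j : cancel (@lat_fwd R d g j) (lat_bwd j).
Proof.
move=> p; apply/ffunP => k; rewrite !ffunE.
by case: eqP => // _; rewrite ordSK.
Qed.

Lemma lat_bwdK j : cancel (@lat_bwd R d g j) (lat_fwd j).
Proof.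
move=> p; apply/ffunP => k; rewrite !ffunE.
by case: eqP => // _; rewrite ord_predK.
Qed.

Lemma G_fwd_bij j : bijective (fun p : G_site g => site_fwd j p : rho_site g).
Proof.
exists (fun p : rho_site g => site_bwd j p : G_site g) => p; apply: val_inj;
  [exact: lat_fwdK | exact: lat_bwdK].
Qed.

Lemma G_bwd_bij j : bijective (fun p : G_site g => site_bwd j p : rho_site g).
Proof.
exists (fun p : rho_site g => site_fwd j p : G_site g) => p; apply: val_inj;
  [exact: lat_bwdK | exact: lat_fwdK].
Qed.

(** The neighbour from which the flux with velocity [c] in direction [j]
    arrives; for [c = 0] the choice is immaterial, as it enters only through
    a factor [`|c|]. *)
Definition upwind_nbr (j : 'I_d) (c : R) (p : G_site g) : G_site g :=
  if 0 <= c then site_bwd j (site_bwd j p) else site_fwd j (site_fwd j p).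

Lemma upwind_nbr_bij j c : bijective (upwind_nbr j c).
Proof.
rewrite /upwind_nbr; case: (0 <= c);
  [exists (fun p : G_site g => site_fwd j (site_fwd j p) : G_site g)
  |exists (fun p : G_site g => site_bwd j (site_bwd j p) : G_site g)] => p;
  apply: val_inj; by rewrite /= ?lat_bwdK ?lat_fwdK ?lat_bwdK ?lat_fwdK.
Qed.

Lemma sum_site (T : finType) (F : 'I_#|T| -> R) :
  \sum_i F i = \sum_(p : T) F (enum_rank p).
Proof. by rewrite (reindex (@enum_rank T)) //; apply/onW_bij/enum_rank_bij. Qed.

(** Summation by parts: periodicity leaves no boundary terms. *)
Lemma frob_DminusH m j (U : 'M[R]_(Ng g, m)) (B : 'M[R]_(Nrho g, m)) :
  frob (DminusH j U) B = - frob U (DplusJ j B).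
Proof.
rewrite !frobE exchange_big [in RHS]exchange_big /= -sumrN.
apply: eq_bigr => k _; rewrite !sum_site.
under eq_bigr do rewrite !mxE enum_rankK -mulrA mulrBl.
under [in RHS]eq_bigr do rewrite !mxE enum_rankK mulrCA mulrBr.
rewrite -!big_distrr /= -mulrN !sumrB opprB; congr (_ * (_ - _)).
  rewrite (reindex _ (onW_bij _ (G_bwd_bij j))) /=.
  apply: eq_bigr => p _; congr (U (enum_rank _) k * _).
  by apply: val_inj; apply: lat_bwdK.
rewrite (reindex _ (onW_bij _ (G_fwd_bij j))) /=.
apply: eq_bigr => p _; congr (U (enum_rank _) k * _).
by apply: val_inj; apply: lat_fwdK.
Qed.

Lemma DplusJ_mulmx m n j (U : 'M[R]_(Nrho g, m)) (B : 'M[R]_(m, n)) :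
  DplusJ j (U *m B) = DplusJ j U *m B.
Proof.
by apply/row_matrixP => i; rewrite row_mul !rowK -scalemxAl mulmxBl /at_site !row_mul.
Qed.

Lemma DplusD m j (U V : 'M[R]_(Ng g, m)) :
  Dplus j (U + V) = Dplus j U + Dplus j V.
Proof. by apply/matrixP => i k; rewrite !mxE; ring. Qed.

Lemma DminusD m j (U V : 'M[R]_(Ng g, m)) :
  Dminus j (U + V) = Dminus j U + Dminus j V.
Proof. by apply/matrixP => i k; rewrite !mxE; ring. Qed.

Lemma min_dx_le j : 0 < min_dx g <= dx g j.
Proof.
rewrite /min_dx; case: pickP => [j0 _|/(_ j) //].
rewrite bigmin_le_cond // andbT; apply: lt_bigmin => [|i _]; exact: dx_gt0.
Qed.

Lemma cell_vol_gt0 : 0 < cell_vol g.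
Proof. by apply: prodr_gt0 => j _; apply: dx_gt0. Qed.

End Grid.

Lemma measD_gt0 (R : realType) d : 0 < measD R d.
Proof.
by rewrite /measD; case: ifP => _; rewrite ?mulr_gt0 ?ltr0n ?pi_gt0.
Qed.

(** * Angular weights and the density *)

Section Angular.
Context (R : realType) (d N : nat) (q : quadrature R d N).

Let M := Mmx q.

Lemma sqr_Mmx : M *m M = diag_mx (\row_k weight q k).
Proof.
apply/matrixP => i k; rewrite mul_diag_mx !mxE; case: eqP => [->|]; last first.
  by rewrite mulr0.
by rewrite !mulr1n -expr2 sqr_sqrtr // ltW // weight_gt0.
Qed.

Lemma Mmx_unit : M \in unitmx.
Proof.
have : M *m M \in unitmx.
  rewrite sqr_Mmx unitmxE det_diag unitfE; apply/prodf_neq0 => k _.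
  by rewrite mxE gt_eqF // weight_gt0.
by rewrite unitmx_mul => /andP[].
Qed.

Lemma tr_Mmx : M^T = M. Proof. exact: tr_diag_mx. Qed.

Lemma MM_ones : M *m M *m ones R N = wvec q.
Proof. by rewrite sqr_Mmx; apply/matrixP => k i; rewrite mul_diag_mx !mxE mulr1. Qed.

(** The removal of the density, conjugated by [M]: in the variable [G M] it
    becomes the orthogonal projection along [M 1], because [|M 1|^2] is the
    sum of the weights. *)
Definition density_proj : 'M[R]_N :=
  1%:M - (measD R d)^-1 *: (M *m ones R N *m (M *m ones R N)^T).

Lemma density_proj_sym : density_proj^T = density_proj.
Proof. by rewrite /density_proj linearB /= linearZ /= trmx_mul trmxK trmx1. Qed.

Lemma ones_MM_ones : (M *m ones R N)^T *m (M *m ones R N) = (measD R d)%:M.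
Proof.
rewrite trmx_mul tr_Mmx -mulmxA mulmxA mulmxA -(mulmxA _ M M) -(mulmxA _ (M *m M)).
rewrite MM_ones; apply/matrixP => i k; rewrite !ord1 !mxE eqxx mulr1n -(weight_sum q).
by apply: eq_bigr => l _; rewrite !mxE mul1r.
Qed.

Lemma density_proj_idem : density_proj *m density_proj = density_proj.
Proof.
have m0 := measD_gt0 R d.
rewrite {2}/density_proj mulmxBr mulmx1 -scalemxAr mulmxA.
suff -> : density_proj *m (M *m ones R N) = 0 by rewrite mul0mx scaler0 subr0.
rewrite /density_proj mulmxBl mul1mx -scalemxAl -(mulmxA _ _ (M *m _)) ones_MM_ones.
by rewrite mul_mx_scalar scalerA mulVf ?gt_eqF // scale1r subrr.
Qed.

Lemma zero_mean_proj_Mmx : zero_mean_proj q *m M = M *m density_proj.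
Proof.
rewrite /zero_mean_proj /density_proj mulmxBl mulmxBr mul1mx mulmx1.
rewrite -scalemxAl -scalemxAr; congr (_ - _ *: _).
by rewrite -MM_ones trmx_mul tr_Mmx !mulmxA.
Qed.

Lemma density_proj_id m (Y : 'M[R]_(m, N)) :
  Y *m (M *m ones R N) = 0 -> Y *m density_proj = Y.
Proof.
by move=> Y0; rewrite mulmxBr mulmx1 -scalemxAr mulmxA Y0 mul0mx scaler0 subr0.
Qed.

End Angular.

(** * Transport operator: adjointness and explicit stability *)

Section Transport.
Context (R : realType) (d N : nat) (g : grid R d) (q : quadrature R d N).

Let M := Mmx q.

(** Splitting by the sign of the velocity selects one of the two one-sided
    differences. *)
Lemma Aop_upwind (G : 'M[R]_(Ng g, N)) (p : G_site g) k :
  Aop q G (enum_rank p) k =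
  \sum_j `|node q k j| / dx g j *
    (G (enum_rank p) k - G (enum_rank (upwind_nbr j (node q k j) p)) k).
Proof.
rewrite /Aop summxE; apply: eq_bigr => j _.
rewrite /Qplus /Qminus /Qmx /absQmx -!scalemxAr mulmxDr mulmxBr.
rewrite !mul_mx_diag !mxE enum_rankK /upwind_nbr.
by case: ger0P => h; rewrite /at_site; field; rewrite gt_eqF ?dx_gt0.
Qed.

Lemma Aop_add (G G' : 'M[R]_(Ng g, N)) : Aop q (G + G') = Aop q G + Aop q G'.
Proof.
rewrite /Aop -big_split; apply: eq_bigr => j _ /=.
by rewrite DplusD DminusD !mulmxDl addrACA.
Qed.

Lemma Bop_add (Y Y' : 'M[R]_(Ng g, N)) : Bop q (Y + Y') = Bop q Y + Bop q Y'.
Proof. by rewrite /Bop !mulmxDl Aop_add !mulmxDl. Qed.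

Lemma Bop_Mmx (G : 'M[R]_(Ng g, N)) :
  Bop q (G *m M) = Aop q G *m zero_mean_proj q *m M.
Proof. by rewrite /Bop mulmxK // Mmx_unit. Qed.

(** The factor [M] on both sides supplies the weights [w], since
    [M M 1 = w]. *)
Lemma Hop_Jop_adjoint (G : 'M[R]_(Ng g, N)) (rho : 'cV[R]_(Nrho g)) :
  measD R d * frob (Hop q G) rho = - frob (G *m M) (Jop q rho *m M).
Proof.
rewrite /Hop frobZl mulrA divff ?gt_eqF ?measD_gt0 // mul1r.
rewrite /Jop mulmx_suml frob_suml [in RHS]frobC frob_suml -sumrN.
apply: eq_bigr => j _; rewrite [in LHS]frob_mulr [in LHS]frob_mulr frob_DminusH.
rewrite [in RHS]frobC frob_mulr tr_Mmx !DplusJ_mulmx; congr (- frob _ _).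
rewrite -MM_ones trmx_mul !trmx_mul !tr_Mmx tr_diag_mx -!mulmxA.
congr (_ *m (_ *m _)).
by rewrite !mulmxA sqr_Mmx -(mulmxA _ M) sqr_Mmx; exact: diag_mxC.
Qed.

Variables (eps dt kappa : R).

Definition explicit_part (Y : 'M[R]_(Ng g, N)) : 'M[R]_(Ng g, N) :=
  dt^-1 *: Y - eps^-1 *: Bop q Y.

Lemma explicit_part_add (Y Y' : 'M[R]_(Ng g, N)) :
  explicit_part (Y + Y') = explicit_part Y + explicit_part Y'.
Proof. by rewrite /explicit_part Bop_add !scalerDr opprD addrACA. Qed.

(** On zero-density matrices the explicit part is an upwind step, acting on
    each angular column separately, followed by [density_proj]. The shifts of
    column [k] have total coefficient at most [d / (eps min dx)], as
    [`|node q k j| <= 1]. *)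
Lemma explicit_part_le (Y : 'M[R]_(Ng g, N)) :
  0 < eps -> dt^-1 <= kappa ->
  2 * (d%:R / (eps * min_dx g)) - dt^-1 <= kappa ->
  Y *m (M *m ones R N) = 0 ->
  frob (explicit_part Y) (explicit_part Y) <= kappa ^+ 2 * frob Y Y.
Proof.
move=> eps0 k1 k2 Y0.
have [G eY] : exists G, Y = G *m M.
  by exists (Y *m invmx M); rewrite mulmxKV // Mmx_unit.
pose U := dt^-1 *: G - eps^-1 *: Aop q G.
have -> : explicit_part Y = U *m M *m density_proj q.
  rewrite /explicit_part -[in dt^-1 *: _](density_proj_id Y0) eY Bop_Mmx.
  rewrite -(mulmxA _ (zero_mean_proj q)).
  by rewrite zero_mean_proj_Mmx mulmxA /U !mulmxBl -!scalemxAl.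
apply: le_trans (frob_proj_le _ (density_proj_sym q) (density_proj_idem q)) _.
rewrite eY !frobE exchange_big [X in _ <= _ * X]exchange_big /= big_distrr /=.
apply: ler_sum => k _.
have wE (B : 'M[R]_(Ng g, N)) : \sum_i (B *m M) i k * (B *m M) i k =
    weight q k * \sum_(p : G_site g) B (enum_rank p) k ^+ 2.
  rewrite sum_site big_distrr; apply: eq_bigr => p _.
  rewrite mul_mx_diag !mxE -expr2 exprMn sqr_sqrtr 1?mulrC //.
  exact/ltW/weight_gt0.
rewrite !wE mulrCA; apply: ler_wpM2l; first exact/ltW/weight_gt0.
pose mu j := eps^-1 * (`|node q k j| / dx g j).
pose y (p : G_site g) := G (enum_rank p) k.
have mu0 j : 0 <= mu j.
  by rewrite /mu !mulr_ge0 ?invr_ge0 // ltW // ?dx_gt0.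
have -> : \sum_(p : G_site g) U (enum_rank p) k ^+ 2 = \sum_(p : G_site g)
    (dt^-1 * y p - \sum_j mu j * (y p - y (upwind_nbr j (node q k j) p))) ^+ 2.
  apply: eq_bigr => p _; rewrite !mxE Aop_upwind big_distrr /=.
  by congr ((_ - _) ^+ 2); apply: eq_bigr => j _; rewrite mulrA.
apply: upwind_step_le => // [j|]; first exact: upwind_nbr_bij.
apply: le_trans k2; rewrite lerB // ler_pM2l //.
apply: (@le_trans _ _ (\sum_(j < d) (eps * min_dx g)^-1)); last first.
  by rewrite sumr_const card_ord mulr_natl.
apply: ler_sum => j _; rewrite /mu invfM ler_pM2l ?invr_gt0 //.
have /andP[m0 mj] := min_dx_le g j.
rewrite -[leRHS]mul1r ler_pM ?invr_ge0 ?(ltW (dx_gt0 g j)) //; first exact: node_le.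
by rewrite lef_pV2 ?posrE ?dx_gt0.
Qed.

End Transport.
(** * Energy balances of the macroscopic step and of the S-step *)

Section Step.
Context (R : realType) (d N r : nat) (g : grid R d) (q : quadrature R d N).
Context (eps dt : R) (sigma_s sigma_a : 'rV[R]_d -> R).
Hypotheses (eps_gt0 : 0 < eps) (dt_gt0 : 0 < dt).
Hypothesis sigma_a_ge0 : forall x, 0 <= sigma_a x.

Let M := Mmx q.

Definition implicit_coef : 'rV[R]_(Ng g) :=
  \row_(i < Ng g) let x := Defs.coord (val (enum_val i : G_site g)) in
    dt^-1 + (eps ^+ 2)^-1 * sigma_s x + sigma_a x.

Lemma implicit_coefE :
  diag_mx implicit_coef =
  (dt^-1)%:M + (eps ^+ 2)^-1 *: on_G_grid g sigma_s + on_G_grid g sigma_a.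
Proof.
by apply/matrixP => i k; rewrite !mxE; case: eqP => _; rewrite ?mulr1n ?mulr0n ?mulr0 ?addr0.
Qed.

(** The macroscopic step is [(1/dt + sigma_a) rho' + Hop G' = rho/dt] for the
    full-rank update [G' M = C^-1 (F (G M) - J)]; testing it with [rho'] turns
    the flux term into a pairing of [G' M] with [J]. *)
Lemma macro_step_energy (rho rho' : 'cV[R]_(Nrho g)) (G : 'M[R]_(Ng g, N)) :
  let J := (eps ^+ 2)^-1 *: (Jop q rho' *m M) in
  macro_step q eps dt sigma_s sigma_a 0 rho G rho' ->
  measD R d * dt^-1 * (frob rho' rho' - frob rho rho)
  <= 2 * eps ^+ 2 *
     frob (invmx (diag_mx implicit_coef) *m (explicit_part q eps dt (G *m M) - J)) J.
Proof.
move=> J; rewrite /macro_step addr0 => /(congr1 (fun A => measD R d * frob A rho')).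
have JE : Jop q rho' *m M = eps ^+ 2 *: J.
  by rewrite /J scalerA mulfV ?scale1r // expf_neq0 // gt_eqF.
clearbody J.
have m0 := measD_gt0 R d.
rewrite mulmxDl mul_scalar_mx !(frobDl, frobNl) !(frobZl dt^-1).
rewrite (frobZl (eps ^+ 2)^-1) !(mulrDr, mulrN).
rewrite (mulrCA _ (eps ^+ 2)^-1) !Hop_Jop_adjoint.
have -> : Rmx g eps dt sigma_s sigma_a = invmx (diag_mx implicit_coef).
  by rewrite /Rmx implicit_coefE.
set Ci := invmx _.
rewrite -!(mulmxA Ci) mulmxBl -!scalemxAl -Bop_Mmx JE -/(explicit_part q eps dt _) -/M.
move: (explicit_part _ _ _ _) => F.
have e0 : eps ^+ 2 != 0 by rewrite expf_neq0 // gt_eqF.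
rewrite -scalemxAr !frobZr frobZl mulmxBr frobDl frobNl => heq.
have a0 : 0 <= measD R d * frob (on_rho_grid g sigma_a *m rho') rho'.
  apply: mulr_ge0; first exact: ltW.
  rewrite -[leLHS](mul0r (frob rho' rho')); apply: le_frob_diag => i.
  by rewrite mxE.
have s0 : 0 <= measD R d * dt^-1 * frob (rho' - rho) (rho' - rho).
  by rewrite !mulr_ge0 ?invr_ge0 ?frob_ge0 // ltW.
move: s0 heq; rewrite !(frobDl, frobDr, frobNl, frobNr) (frobC rho' rho).
rewrite (mulrN (eps ^- 2)) mulKf // !opprK.
by lra.
Qed.

(** The S-step is the compression to the new bases of
    [C Y' = F Yt - J], and [Y'] lies in the compressed space. *)
Lemma S_step_galerkin (rho' : 'cV[R]_(Nrho g)) (X' : 'M[R]_(Ng g, r))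
  (V' : 'M[R]_(N, r)) (St S' : 'M[R]_r) :
  let Y' := X' *m S' *m V'^T in
  let Yt := X' *m St *m V'^T in
  X'^T *m X' = 1%:M -> V'^T *m V' = 1%:M ->
  S_step q eps dt sigma_s sigma_a rho' X' V' St S' ->
  frob (diag_mx implicit_coef *m Y') Y'
  = frob (explicit_part q eps dt Yt - (eps ^+ 2)^-1 *: (Jop q rho' *m M)) Y'.
Proof.
move=> Y' Yt XX VV hS.
have test (A : 'M[R]_(Ng g, N)) : frob A Y' = frob (X'^T *m A *m V') S'.
  by rewrite /Y' frobC frob_mulr trmxK frob_mull frobC mulmxA.
rewrite !test; congr (frob _ _).
rewrite implicit_coefE /explicit_part /Y' !mulmxA -[LHS]mulmxA VV mulmx1.
rewrite !(mulmxDr, mulmxDl, mulmxN, mulNmx) -!(scalemxAl, scalemxAr).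
rewrite mul_mx_scalar -!scalemxAl XX mul1mx.
have -> : X'^T *m Yt *m V' = St.
  by rewrite /Yt !mulmxA XX mul1mx -mulmxA VV mulmx1.
move: hS; rewrite /S_step scalerBr -/M => /eqP.
rewrite subr_eq => /eqP ->; rewrite !mulmxA /Yt.
by apply/matrixP => i k; rewrite !mxE; ring.
Qed.

Lemma density_free_compress (X : 'M[R]_(Ng g, r)) (S : 'M[R]_r) (V : 'M[R]_(N, r)) :
  (ones R N)^T *m M *m V = 0 -> X *m S *m V^T *m (M *m ones R N) = 0.
Proof.
move=> /(congr1 trmx); rewrite !trmx_mul trmxK tr_Mmx trmx0 => V0.
by rewrite -mulmxA V0 mulmx0.
Qed.

End Step.

(** * Energy decay over one step *)

Section StepEnergy.
Context (R : realType) (d N r : nat) (g : grid R d) (q : quadrature R d N).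

Lemma energyE eps sigma0 theta dt rho (G : 'M[R]_(Ng g, N)) :
  energy q eps sigma0 theta dt rho G = cell_vol g *
    (measD R d * frob rho rho + (eps ^+ 2 + (1 - theta) * dt * sigma0)
      * frob (G *m Mmx q) (G *m Mmx q)).
Proof.
rewrite /energy /norm_rho /norm_w.
have -> : dot_rho rho rho = cell_vol g * frob rho rho.
  rewrite /dot_rho frobE mxE; congr (_ * _); apply: eq_bigr => i _.
  by rewrite big_ord1 mxE.
have -> : dot_w q G G = cell_vol g * frob (G *m Mmx q) (G *m Mmx q).
  by rewrite /dot_w /frob trmx_mul tr_Mmx !mulmxA.
rewrite !sqr_sqrtr ?mulr_ge0 ?frob_ge0 ?(ltW (cell_vol_gt0 g)) //.
by ring.
Qed.

Lemma step_admissible eps dt sigma_s sigma_a Phi (u u' : lr_state N g r) :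
  imex_s_bug_step q eps dt sigma_s sigma_a Phi u u' -> admissible q u'.
Proof.
move=> [K' [L' [_ [_ [_ [[XX _] [[VV _] [V0 [_ hG]]]]]]]]].
by split.
Qed.

Lemma step_energy_le (eps dt sigma0 theta kappa : R)
  (sigma_s sigma_a : 'rV[R]_d -> R) (u u' : lr_state N g r) :
  0 < eps -> 0 < dt ->
  (forall x, sigma0 <= sigma_s x) -> (forall x, 0 <= sigma_a x) ->
  kappa = dt^-1 + (1 - theta) * sigma0 / eps ^+ 2 ->
  0 <= (1 - theta) * sigma0 <= sigma0 ->
  2 * (d%:R / (eps * min_dx g)) - dt^-1 <= kappa ->
  admissible q u ->
  imex_s_bug_step q eps dt sigma_s sigma_a 0 u u' ->
  energy q eps sigma0 theta dt (st_rho u') (st_G u')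
  <= energy q eps sigma0 theta dt (st_rho u) (st_G u).
Proof.
move=> eps0 dt0 hs ha kE /andP[th0 th1] cfl [hY XX VV V0].
move=> [K' [L' [hM [_ [_ [[XX' _] [[VV' _] [V0' [hS hY']]]]]]]]].
set Y := st_G u *m Mmx q in hY; set Y' := st_G u' *m Mmx q in hY'.
set rho' := st_rho u' in hM hS *.
pose C := diag_mx (implicit_coef g eps dt sigma_s sigma_a).
pose J := (eps ^+ 2)^-1 *: (Jop q rho' *m Mmx q).
pose St := (st_X u')^T *m Y *m st_V u'.
pose Yt := st_X u' *m St *m (st_V u')^T.
have e2 : 0 < eps ^+ 2 by rewrite exprn_gt0.
have k1 : dt^-1 <= kappa by rewrite kE lerDl divr_ge0 // ltW.
have k0 : 0 < kappa by apply: lt_le_trans k1; rewrite invr_gt0.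
have ck i : kappa <= implicit_coef g eps dt sigma_s sigma_a ord0 i.
  rewrite mxE /= kE -addrA lerD2l -[leLHS]addr0 lerD // mulrC ler_pM2l ?invr_gt0 //.
  exact: le_trans th1 _.
have c0 i := lt_le_trans k0 (ck i).
have F0 (A : 'M[R]_(Ng g, N)) : A *m (Mmx q *m ones R N) = 0 ->
    frob (invmx C *m explicit_part q eps dt A) (explicit_part q eps dt A)
    <= kappa * frob A A.
  move=> A0; have := explicit_part_le eps0 k1 cfl A0.
  rewrite -(ler_pM2l (_ : 0 < kappa^-1)) ?invr_gt0 // mulrA expr2 mulKf ?gt_eqF //.
  apply: le_trans; rewrite /C invmx_diag //; apply: frob_diag_le => i.
  by rewrite mxE lef_pV2 ?posrE.
have Y0 : Y *m (Mmx q *m ones R N) = 0 by rewrite hY density_free_compress.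
have Yt0 : Yt *m (Mmx q *m ones R N) = 0 by rewrite density_free_compress.
have Z0 : (Y - Yt) *m (Mmx q *m ones R N) = 0 by rewrite mulmxBl Y0 Yt0 subrr.
have hsplit : frob Y Y = frob Yt Yt + frob (Y - Yt) (Y - Yt).
  exact: frob_compress_split XX' VV' erefl.
have hm := macro_step_energy eps0 dt0 ha hM.
have hS' : S_step q eps dt sigma_s sigma_a rho' (st_X u') (st_V u') St (st_S u').
  by move: hS; rewrite /St hY !mulmxA.
have := S_step_galerkin XX' VV' hS'; rewrite /= -hY' -/C -/Yt -/J => hg.
have := coupled_energy_le c0 (explicit_part q eps dt (Y - Yt)) hg.
rewrite -explicit_part_add addrCA subrr addr0.
have := F0 _ Yt0; have := F0 _ Z0; have := le_frob_diag Y' ck.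
move: hm; rewrite -/Y -/J -/C !energyE -/Y -/Y' => hm hY'C hZ hYt hc.
apply: ler_wpM2l; first exact/ltW/cell_vol_gt0.
have hk : eps ^+ 2 + (1 - theta) * dt * sigma0 = dt * (eps ^+ 2 * kappa).
  by rewrite kE; field; rewrite !gt_eqF.
set coupling := frob (invmx C *m (explicit_part q eps dt Y - J)) J in hm hc.
have hcore : 2 * coupling + kappa * (frob Y' Y' - frob Y Y) <= 0.
  rewrite hsplit mulrBr mulrDr addrA subr_le0.
  by apply: le_trans (lerD hYt hZ); apply: le_trans hc; rewrite lerD2l.
move: (frob rho' rho') (frob _ (st_rho u)) hm => b' b hm.
rewrite hk; move: (frob Y' Y') (frob Y Y) (coupling) hcore hm => a' a p hcore hm.
rewrite -subr_le0.
have -> : measD R d * b' + dt * (eps ^+ 2 * kappa) * a'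
    - (measD R d * b + dt * (eps ^+ 2 * kappa) * a)
  = dt * (measD R d * dt^-1 * (b' - b) + eps ^+ 2 * (kappa * (a' - a))).
  by field; rewrite gt_eqF.
rewrite pmulr_rle0 //; apply: le_trans (lerD hm (lexx _)) _.
have -> : 2 * eps ^+ 2 * p + eps ^+ 2 * (kappa * (a' - a))
  = eps ^+ 2 * (2 * p + kappa * (a' - a)) by ring.
by rewrite pmulr_rle0.
Qed.

End StepEnergy.

Theorem theorem4p1 (R : realType) (d N r : nat) (hd : d = 1%N \/ d = 2%N)
  (g : grid R d) (q : quadrature R d N)
  (eps : R) (heps : 0 < eps)
  (sigma0 : R) (hsigma0 : 0 < sigma0)
  (sigma_s sigma_a : 'rV[R]_d -> R)
  (hsigma_s : forall x, sigma0 <= sigma_s x)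
  (hsigma_a : forall x, 0 <= sigma_a x)
  (Phi : nat -> 'cV[R]_(Nrho g)) (hPhi : forall n, Phi n = 0)
  (theta : R) (htheta : 0 <= theta <= 1)
  (dt : R) (hdt : 0 < dt)
  (hCFL : (eps * C_A R * d%:R / (2 * min_dx g)
           - (1 - theta) / (4 * Omega_inf R) * sigma0) * dt
          <= eps ^+ 2 / (2 * Omega_inf R))
  (u : nat -> lr_state N g r)
  (hinit : admissible q (u 0%N))
  (hstep : forall n, imex_s_bug_step q eps dt sigma_s sigma_a
                       (Phi n.+1) (u n) (u n.+1)) :
  forall n, energy q eps sigma0 theta dt (st_rho (u n.+1)) (st_G (u n.+1))
            <= energy q eps sigma0 theta dt (st_rho (u n)) (st_G (u n)).
Proof.
move=> n; have adm k : admissible q (u k).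
  by case: k => [//|k]; apply: step_admissible (hstep k).
have /andP[th0 th1] := htheta.
have min0 : 0 < min_dx g.
  have [j _] : exists j : 'I_d, true by case: hd => ->; exists ord0.
  by have /andP[] := min_dx_le g j.
have step := hstep n; rewrite hPhi in step.
apply: (step_energy_le heps hdt hsigma_s hsigma_a erefl _ _ (adm n) step).
  have t0 : 0 <= theta * sigma0 by rewrite mulr_ge0 // ltW.
  have t1 : 0 <= (1 - theta) * sigma0 by rewrite mulr_ge0 ?subr_ge0 // ltW.
  by rewrite t1 /=; lra.
(* The time step restriction is multiplied by [2 / (eps^2 dt)]. *)
have c2 : 0 < 2 * eps ^- 2 * dt^-1.
  by rewrite !mulr_gt0 ?invr_gt0 ?exprn_gt0.
move: hCFL; rewrite /C_A /Omega_inf -(ler_pM2l c2).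
have -> : 2 * eps ^- 2 * dt^-1 * ((eps * 1 * d%:R / (2 * min_dx g)
   - (1 - theta) / (4 * 1) * sigma0) * dt)
  = d%:R / (eps * min_dx g) - (1 - theta) * sigma0 / eps ^+ 2 / 2.
  by field; rewrite !gt_eqF.
have -> : 2 * eps ^- 2 * dt^-1 * (eps ^+ 2 / (2 * 1)) = dt^-1.
  by field; rewrite !gt_eqF.
by lra.
Qed.
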